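(* The heat flow $\varrho_t$ converges exponentially fast to the equilibrium $\mathbf{1}$ in $\mathrm{L}^2(\mathcal{X},\varpi)$-distance. That is, for every $\varrho_0\in\mathcal{M}_+$, if $(\varrho_t)_{t\ge0}$ is the solution in $\mathcal{M}_+$ with initial state $\varrho_0$ of $$\dot\varrho_t=b^{-2}\Delta\varrho_t-a^{-2}\langle\log\varrho_t,p\rangle_\varpi\,p,$$ then there exist constants $C,c>0$ (possibly depending on $\varrho_0$) such that $$\|\varrho_t-\mathbf{1}\|_{\varpi,2}\le C e^{-ct}\qquad\text{for all }t\ge0.$$
   Context: Setting. $\mathcal{X}$ is a finite set with $N$ points, $K:\mathcal{X}\times\mathcal{X}\to[0,\infty)$ is an irreducible Markov kernel (row-stochastic matrix), and $\varpi:\mathcal{X}\to[0,\infty)$ is its unique steady-state probability distribution ($\varpi(x)=\sum_{y}\varpi(y)K(y,x)$, $\sum_y\varpi(y)=1$). $\varpi$ is assumed reversible: $K(x,y)\varpi(x)=K(y,x)\varpi(y)$ for all $x,y$. $\mathcal{M}_+=\{\mu:\mathcal{X}\to\mathbb{R}\mid\mu(x)>0\ \forall x\}$. Fixed throughout: real numbers $a,b>0$ and $p\in\mathcal{M}_+$ with $\sum_x\varpi(x)p(x)=1$. Notation: $\langle\varphi,\psi\rangle_\varpi=\sum_x\varphi(x)\psi(x)\varpi(x)$ and $\|\psi\|_{\varpi,2}=\langle\psi,\psi\rangle_\varpi^{1/2}$ for $\varphi,\psi\in\mathbb{R}^{\mathcal{X}}$; $\mathrm{L}^2(\mathcal{X},\varpi)$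 is $\mathbb{R}^{\mathcal{X}}$ with this inner product; $\log\varrho$ is taken pointwise; $\Delta\psi(x)=\sum_yK(x,y)(\psi(y)-\psi(x))$; $\mathbf{1}=(1,\dots,1)\in\mathbb{R}^{\mathcal{X}}$. For every $\varrho_0\in\mathcal{M}_+$ the Cauchy problem for the displayed equation has a unique global solution in $\mathrm{C}^1([0,\infty);\mathcal{M}_+)$, called the heat flow. *)

(* Defs.v *)
From HB Require Import structures.
From mathcomp Require Import all_boot all_order all_algebra.
From mathcomp Require Import all_classical all_reals all_analysis.
Import Order.TTheory GRing.Theory Num.Theory.
Import numFieldNormedType.Exports.

Set Implicit Arguments.
Unset Strict Implicit.
Unset Printing Implicit Defensive.

Local Open Scope classical_set_scope.
Local Open Scope ring_scope.

Section FiniteMarkovChain.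
Context {R : realType} {X : finType}.
Implicit Types (K : X -> X -> R) (w p mu phi psi : X -> R).

Definition markov_kernel K :=
  (forall x y, 0 <= K x y) /\ (forall x, \sum_y K x y = 1).

(* Any two states are joined by a finite chain of transitions of positive
   probability. *)
Definition irreducible_kernel K :=
  forall x y, connect [rel u v | 0 < K u v] x y.

Definition steady_state K w :=
  [/\ forall x, 0 <= w x,
      \sum_x w x = 1 &
      forall x, w x = \sum_y w y * K y x].

Definition reversible K w := forall x y, K x y * w x = K y x * w y.

Definition positive mu := forall x, 0 < mu x.

Definition inner w phi psi : R := \sum_x phi x * psi x * w x.

Definition norm2 w psi : R := Num.sqrt (inner w psi psi).

Definition laplacian K psi (x : X) : R := \sum_y K x y * (psi y - psi x).

Definition heat_field K w p (a b : R) mu (x : X) : R :=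
  b ^- 2 * laplacian K mu x
  - a ^- 2 * inner w (fun y => ln (mu y)) p * p x.

End FiniteMarkovChain.

(* Derivative relative to [0, +oo[: one-sided at t = 0, and the usual
   two-sided derivative at t > 0. *)
Definition is_derive_halfline {R : realType} (f : R -> R) (t l : R) :=
  (fun s => (f s - f t) / (s - t)) @ within `[0, +oo[ t^' --> l.

Definition C1_halfline {R : realType} (f df : R -> R) :=
  (forall t : R, 0 <= t -> is_derive_halfline f t (df t)) /\
  {within `[0, +oo[, continuous df}.

(* Only the values rho t with t >= 0 are constrained. *)
Definition heat_flow {R : realType} {X : finType} (K : X -> X -> R)
    (w p : X -> R) (a b : R) (rho0 : X -> R) (rho : R -> X -> R) :=
  [/\ forall t : R, 0 <= t -> positive (rho t),
      forall x, rho 0 x = rho0 x &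
      forall x, C1_halfline (rho^~ x) (fun t => heat_field K w p a b (rho t) x)].

(* Main.v *)
(** Along the flow the entropy [H = \sum_x w x (r ln r - r + 1)], [r = rho t x],
    decreases: reversibility gives [H' = - D] with
    [D = b^-2 E(rho, ln rho) + a^-2 L^2], where [E] is the Dirichlet form and
    [L] the average of [ln rho] against the probability [w p].  Bounded entropy
    bounds [rho] from above by some [M], and then [c H <= D]: up to factors [M],
    [E(rho, ln rho)] dominates [E(rho, rho)], hence by a Poincare inequality the
    squared oscillation of [rho], while [L] controls the distance of [1] to the
    range of [rho], so [D] dominates each [(rho x - 1)^2] and thus [H].
    Gronwall's lemma makes [H] decay exponentially, and below [M] the entropy
    dominates the squared L2 distance. *)

Require Import Defs.
From HB Require Import structures.
From mathcomp Require Import all_boot all_order all_algebra.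
From mathcomp Require Import all_classical all_reals all_analysis.
From mathcomp Require Import ring lra.
Import Order.TTheory GRing.Theory Num.Theory.
Import numFieldNormedType.Exports.

Set Implicit Arguments.
Unset Strict Implicit.

Local Open Scope classical_set_scope.
Local Open Scope ring_scope.

(** * Pointwise inequalities for the logarithm and the entropy density *)

Section LogarithmicInequalities.
Context {R : realType}.
Implicit Types u v M : R.

Lemma ln_le_sub1 u : 0 < u -> ln u <= u - 1.
Proof.
by move=> u0; rewrite -[in leLHS](subrK 1 u) addrC le_ln1Dx// ltrBrDr addNr.
Qed.

Lemma ln_ge_1subV u : 0 < u -> 1 - u^-1 <= ln u.
Proof.
move=> u0; have := @ln_le_sub1 u^-1; rewrite invr_gt0 lnV ?posrE// => /(_ u0).
by rewrite lerNl opprB.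
Qed.

Lemma mul_ln_ge u : 0 < u -> u - 1 <= u * ln u.
Proof.
move=> u0; have := ln_ge_1subV u0.
by rewrite -(ler_pM2l u0) mulrBr mulr1 divff ?gt_eqF.
Qed.

Lemma entropy_density_ge0 u : 0 < u -> 0 <= u * ln u - u + 1.
Proof. by move=> /mul_ln_ge; lra. Qed.

Lemma entropy_density_le_sqr u : 0 < u -> u * ln u - u + 1 <= (u - 1) ^+ 2.
Proof. by move=> u0; have := ln_le_sub1 u0; nra. Qed.

(* [e - 1] comes from the tangent of the convex function at [u = e]. *)
Lemma le_entropy_density u : 0 < u -> u <= u * ln u - u + 1 + (expR 1 - 1).
Proof.
move=> u0; have e0 := expR_gt0 (1 : R).
have ue0 : 0 < u / expR 1 by exact: divr_gt0.
have := mul_ln_ge ue0; rewrite ln_div ?posrE// expRK => h.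
have : expR 1 * (u / expR 1 - 1) <= expR 1 * (u / expR 1 * (ln u - 1)).
  by rewrite ler_pM2l.
have ->: expR 1 * (u / expR 1 - 1) = u - expR 1 by field; rewrite gt_eqF.
have ->: expR 1 * (u / expR 1 * (ln u - 1)) = u * ln u - u.
  by field; rewrite gt_eqF.
by lra.
Qed.

(* With [s = sqrt u], both sides compare with [(s - 1) ^+ 2]. *)
Lemma sqr_le_entropy_density u M : 0 < u -> u <= M ->
  (u - 1) ^+ 2 <= 2 * (M + 1) * (u * ln u - u + 1).
Proof.
move=> u0 uM; set s := Num.sqrt u.
have s0 : 0 < s by rewrite sqrtr_gt0.
have us : u = s ^+ 2 by rewrite sqr_sqrtr ?ltW.
have hs := mul_ln_ge s0.
have lnu : ln u = 2 * ln s by rewrite us lnXn// mulr_natl.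
have h1 : (s - 1) ^+ 2 <= u * ln u - u + 1.
  have : s * (s - 1) <= s * (s * ln s) by rewrite ler_pM2l.
  by rewrite lnu us; lra.
have h2 : (s + 1) ^+ 2 <= 2 * (M + 1).
  by have := sqr_ge0 (s - 1); lra.
have -> : (u - 1) ^+ 2 = (s + 1) ^+ 2 * (s - 1) ^+ 2 by rewrite us; ring.
by apply: ler_pM => //; exact: sqr_ge0.
Qed.

(** By symmetry [v <= u]; then multiply [1 - v / u <= ln (u / v)] by [u <= M]. Edge by edge this
    compares E(rho, rho) with E(rho, ln rho). *)
Lemma sqr_sub_le_mul_sub_ln u v M : 0 < u -> 0 < v -> u <= M -> v <= M ->
  (u - v) ^+ 2 <= M * ((u - v) * (ln u - ln v)).
Proof.
wlog vu : u v / v <= u => [hwlog|] u0 v0 uM vM.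
  have [/hwlog|/ltW/hwlog] := leP v u; first exact.
  by move=> /(_ v0 u0 vM uM); lra.
have := ln_ge_1subV (divr_gt0 u0 v0).
rewrite ln_div ?posrE// invf_div => h.
have h1 : u - v <= u * (ln u - ln v).
  have -> : u - v = u * (1 - v / u) by field; rewrite gt_eqF.
  by rewrite ler_pM2l.
have l0 : 0 <= ln u - ln v by rewrite subr_ge0 ler_ln.
have h2 : u - v <= M * (ln u - ln v) by apply: le_trans h1 _; exact: ler_wpM2r.
rewrite expr2 mulrCA; apply: ler_wpM2l => //; lra.
Qed.

End LogarithmicInequalities.

(** * Dirichlet form, Poincare inequality, entropy and dissipation *)

Section FiniteSums.
Context {R : realType} {X : finType}.
Implicit Types (w p f g mu : X -> R) (K : X -> X -> R).

(* Each unordered pair of states is counted twice. *)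
Definition dirichlet K w f g :=
  \sum_x \sum_y w x * K x y * ((f x - f y) * (g x - g y)).

(** Summation by parts: reversibility lets the two states be exchanged in the double sum, and
    averaging both forms makes the increment of [g] appear. *)
Lemma inner_laplacian K w f g : reversible K w ->
  inner w (laplacian K f) g = - (dirichlet K w f g / 2).
Proof.
move=> hrev.
have e1 : inner w (laplacian K f) g =
    \sum_x \sum_y w x * K x y * ((f y - f x) * g x).
  apply: eq_bigr => x _; rewrite /laplacian !mulr_suml; apply: eq_bigr => y _.
  ring.
have e2 : inner w (laplacian K f) g =
    \sum_x \sum_y w x * K x y * ((f x - f y) * g y).
  rewrite e1 exchange_big; apply: eq_bigr => x _; apply: eq_bigr => y _ /=.
  by rewrite (mulrC (w y)) hrev (mulrC (w x)).
suff : inner w (laplacian K f) g + inner w (laplacian K f) g =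
    - dirichlet K w f g by lra.
rewrite {1}e1 e2 -big_split -sumrN; apply: eq_bigr => x _ /=.
rewrite -big_split -sumrN; apply: eq_bigr => y _ /=; ring.
Qed.

(** Total mass 1 forces some [z] to carry mass, and stationarity passes positivity along every
    transition of a path from [z] to [x]. *)
Lemma steady_state_gt0 K w : markov_kernel K -> irreducible_kernel K ->
  steady_state K w -> forall x, 0 < w x.
Proof.
move=> [K0 _] hirr [w0 w1 wK] x.
have [z wz] : exists z, 0 < w z.
  apply/not_existsP => h.
  have : \sum_x w x = 0.
    by apply: big1 => y _; apply/eqP; rewrite eq_le w0 andbT leNgt; apply/negP.
  by rewrite w1 => /eqP; rewrite oner_eq0.
have /connectP[s hs ->] := hirr z x.
elim: s z wz hs => //= y s ih z wz /andP[Kzy hs]; apply: ih => //.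
rewrite wK (bigD1 z)//= ltr_wpDr ?mulr_gt0//.
by apply: sumr_ge0 => i _; rewrite mulr_ge0.
Qed.

Lemma dirichlet_ge0 K w f : (forall x y, 0 <= K x y) -> (forall x, 0 <= w x) ->
  0 <= dirichlet K w f f.
Proof.
move=> K0 w0; do 2!apply: sumr_ge0 => ? _.
by rewrite -expr2 mulr_ge0 ?sqr_ge0// mulr_ge0.
Qed.

Lemma dirichlet_ln_ge0 K w mu : (forall x y, 0 <= K x y) ->
  (forall x, 0 <= w x) -> positive mu ->
  0 <= dirichlet K w mu (fun x => ln (mu x)).
Proof.
move=> K0 w0 mu0; apply: sumr_ge0 => x _; apply: sumr_ge0 => y _.
apply: mulr_ge0; first exact: mulr_ge0.
have [yx|/ltW xy] := leP (mu y) (mu x).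
  by rewrite mulr_ge0 ?subr_ge0 ?ler_ln ?posrE.
by rewrite mulr_le0 ?subr_le0 ?ler_ln ?posrE.
Qed.

(** A single edge is one term of the form. A path is handled by induction, splitting off its first
    edge with [(r + s)^2 <= 2 r^2 + 2 s^2]. *)
Lemma poincare K w : markov_kernel K -> irreducible_kernel K ->
  (forall x, 0 < w x) ->
  exists2 C, 0 <= C & forall f x y, (f x - f y) ^+ 2 <= C * dirichlet K w f f.
Proof.
move=> [K0 _] hirr w0.
have edge x y f : w x * K x y * (f x - f y) ^+ 2 <= dirichlet K w f f.
  have nn u v : 0 <= w u * K u v * ((f u - f v) * (f u - f v)).
    by rewrite -expr2 mulr_ge0 ?sqr_ge0// mulr_ge0// ltW.
  rewrite /dirichlet (bigD1 x)//= (bigD1 y)//= -addrA expr2 lerDl addr_ge0//.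
    by apply: sumr_ge0.
  by apply: sumr_ge0 => u _; apply: sumr_ge0.
have D0 f : 0 <= dirichlet K w f f.
  by apply: dirichlet_ge0 => // x; exact: ltW.
have pair (xy : X * X) : exists C, 0 <= C /\
    forall f, (f xy.1 - f xy.2) ^+ 2 <= C * dirichlet K w f f.
  case: xy => x y /=; have /connectP[s hs ->] := hirr x y.
  elim: s x hs => /= [|z s ih] x; first by exists 0; split=> // f; lra.
  move=> /andP[Kxz /ih[C [C0 hC]]].
  have wK0 : 0 < w x * K x z by rewrite mulr_gt0.
  exists (2 * (w x * K x z)^-1 + 2 * C); split.
    by rewrite addr_ge0// mulr_ge0// invr_ge0 ltW.
  move=> f; have h1 : (f x - f z) ^+ 2 <= (w x * K x z)^-1 * dirichlet K w f f.
    by rewrite ler_pdivlMl//; exact: edge.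
  have := hC f; move: h1; set k := _^-1; set l := f (last _ _) => h1 h2.
  by have := sqr_ge0 ((f x - f z) - (f z - l)); lra.
have /choice[C hC] := pair.
(* The sum over all pairs of states makes the constant uniform. *)
exists (\sum_xy C xy); first by apply: sumr_ge0 => xy _; have [] := hC xy.
move=> f x y; have [_ /(_ f)/le_trans] := hC (x, y); apply.
apply: ler_wpM2r => //; rewrite (bigD1 (x, y))//= lerDl.
by apply: sumr_ge0 => xy _; have [] := hC xy.
Qed.

(** The flow need not preserve total mass; the terms [- mu x + 1] keep every summand nonnegative
    without normalising [mu]. *)
Definition entropy w mu := \sum_x w x * (mu x * ln (mu x) - mu x + 1).

Definition dissipation K w p (a b : R) mu :=
  b ^- 2 * (dirichlet K w mu (fun x => ln (mu x)) / 2)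
  + a ^- 2 * inner w (fun x => ln (mu x)) p ^+ 2.

(** Since [ln] is the derivative of the entropy density, this is the rate of change of the entropy
    along the flow. *)
Lemma inner_ln_heat_field K w p a b mu : reversible K w ->
  \sum_x w x * (ln (mu x) * heat_field K w p a b mu x) =
  - dissipation K w p a b mu.
Proof.
move=> hrev; rewrite /heat_field; set L := inner _ _ _.
have -> : - dissipation K w p a b mu =
    b ^- 2 * inner w (laplacian K mu) (fun x => ln (mu x)) -
    a ^- 2 * L * \sum_x ln (mu x) * p x * w x.
  by rewrite inner_laplacian// /dissipation -/L -[\sum_x _ * p x * _]/L; ring.
rewrite {1}/inner !mulr_sumr -sumrB; apply: eq_bigr => x _.
ring.
Qed.

Lemma dissipation_ge0 K w p a b mu : markov_kernel K -> (forall x, 0 <= w x) ->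
  0 < a -> 0 < b -> positive mu -> 0 <= dissipation K w p a b mu.
Proof.
move=> [K0 _] w0 a0 b0 mu0.
have ab c : 0 < c -> 0 <= c ^- 2 :> R.
  by move=> c0; rewrite invr_ge0 exprn_ge0 ?ltW.
rewrite addr_ge0// mulr_ge0 ?ab ?sqr_ge0//.
by rewrite divr_ge0// dirichlet_ln_ge0.
Qed.

Lemma entropy_ge0 w mu : (forall x, 0 <= w x) -> positive mu ->
  0 <= entropy w mu.
Proof.
move=> w0 mu0; apply: sumr_ge0 => x _.
by rewrite mulr_ge0// entropy_density_ge0.
Qed.

Lemma le_entropy w mu x : (forall x, 0 < w x) -> positive mu ->
  mu x <= entropy w mu / w x + (expR 1 - 1).
Proof.
move=> w0 mu0; apply: (le_trans (le_entropy_density (mu0 x))).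
rewrite lerD2r ler_pdivlMr// mulrC /entropy (bigD1 x)//= lerDl.
apply: sumr_ge0 => y _.
by rewrite mulr_ge0 ?entropy_density_ge0 ?(ltW (w0 _)).
Qed.

Lemma entropy_dissipation K w p a b M : markov_kernel K ->
  irreducible_kernel K -> steady_state K w -> 0 < a -> 0 < b -> positive p ->
  \sum_x w x * p x = 1 -> 1 <= M ->
  exists2 c, 0 < c & forall mu, positive mu -> (forall x, mu x <= M) ->
    c * entropy w mu <= dissipation K w p a b mu.
Proof.
move=> hK hirr hw a0 b0 p0 p1 M1; have w0 := steady_state_gt0 hK hirr hw.
have [C C0 hC] := poincare hK hirr w0.
have [K0 _] := hK; have [_ w1 _] := hw.
(* The first summand pays for the oscillation through the Dirichlet part, the second for [L ^+ 2];
   the cross terms are nonnegative. *)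
pose c := 4 * C * M * b ^+ 2 + 2 * M ^+ 2 * a ^+ 2.
have c0 : 0 < c.
  have M0 : 0 < M by lra.
  by rewrite /c ltr_wpDl ?mulr_gt0 ?exprn_gt0// !mulr_ge0 ?sqr_ge0// ltW.
exists c^-1; first by rewrite invr_gt0.
move=> mu mu0 muM; rewrite ler_pdivrMl//.
set L := inner w (fun x => ln (mu x)) p.
set D := dirichlet K w mu (fun x => ln (mu x)).
(* By the Poincare inequality [d] bounds the oscillation of [mu]. *)
pose d := Num.sqrt (C * dirichlet K w mu mu).
have d0 : 0 <= d by exact: sqrtr_ge0.
have osc x y : `|mu x - mu y| <= d by rewrite -sqrtr_sqr ler_wsqrtr.
have dD : d ^+ 2 <= C * (M * D).
  rewrite sqr_sqrtr; last first.
    by rewrite mulr_ge0// dirichlet_ge0// => x; exact: ltW.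
  apply: ler_wpM2l => //; rewrite /D /dirichlet mulr_sumr.
  apply: ler_sum => x _.
  rewrite mulr_sumr; apply: ler_sum => y _.
  rewrite (mulrCA M); apply: ler_wpM2l; first by rewrite mulr_ge0 ?(ltW (w0 _)).
  by rewrite -expr2; exact: sqr_sub_le_mul_sub_ln.
(* [L] is the average of [ln mu] against the probability [w * p]. *)
have avg_le u : (forall y, ln (mu y) <= u) -> L <= u.
  move=> h; rewrite -[u]mul1r -p1 mulr_suml; apply: ler_sum => y _.
  have -> : ln (mu y) * p y * w y = w y * p y * ln (mu y) by ring.
  by rewrite ler_wpM2l// mulr_ge0// ltW.
have avg_ge u : (forall y, u <= ln (mu y)) -> u <= L.
  move=> h; rewrite -[u]mul1r -p1 mulr_suml; apply: ler_sum => y _.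
  have -> : ln (mu y) * p y * w y = w y * p y * ln (mu y) by ring.
  by rewrite ler_wpM2l// mulr_ge0// ltW.
(* Only the case of 1 farther than [d] from [mu x] matters; all values of [mu] then lie on one side
   of 1. Below, [L <= mu x + d - 1 < 0]; above, [r = mu x - d] satisfies
   [r - 1 <= r * ln r <= M * L]. *)
have near1 x : `|mu x - 1| <= d + M * `|L|.
  have ML0 : 0 <= M * `|L| by rewrite mulr_ge0// (le_trans ler01).
  rewrite ler_norml; apply/andP; split.
    have [h|h] := leP 1 (mu x + d); first by lra.
    have : L <= mu x + d - 1.
      apply: avg_le => y; apply: (le_trans (ln_le_sub1 (mu0 y))).
      by have := osc x y; rewrite ler_norml => /andP[]; lra.
    have := ler_norm (- L); rewrite normrN.
    have : `|L| <= M * `|L| by rewrite ler_peMl.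
    by lra.
  have [h|h] := leP (mu x - d) 1; first by lra.
  have r0 : 0 < mu x - d by lra.
  have : ln (mu x - d) <= L.
    apply: avg_ge => y; rewrite ler_ln ?posrE//.
    by have := osc x y; rewrite ler_norml => /andP[]; lra.
  have := mul_ln_ge r0.
  have := ln_gt0 h; have := ler_norm L; set l := ln _ => Ll l0 h1 lL.
  have : (mu x - d) * l <= M * `|L|.
    by apply: ler_pM; have := muM x; lra.
  by lra.
have sqr1 x : (mu x - 1) ^+ 2 <= c * dissipation K w p a b mu.
  have : (mu x - 1) ^+ 2 <= (d + M * `|L|) ^+ 2.
    rewrite -[leLHS]real_normK ?num_real// lerXn2r// nnegrE//.
    by rewrite (le_trans _ (near1 x)).
  have : (d + M * `|L|) ^+ 2 <= 2 * d ^+ 2 + 2 * (M ^+ 2 * L ^+ 2).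
    have := sqr_ge0 (d - M * `|L|).
    by rewrite -[L ^+ 2]real_normK ?num_real//; lra.
  suff : 2 * (C * (M * D)) + 2 * (M ^+ 2 * L ^+ 2) <=
      c * dissipation K w p a b mu by lra.
  have D0 : 0 <= D by apply: dirichlet_ln_ge0 => // y; exact: ltW.
  rewrite /dissipation -/L -/D.
  have -> : c * (b ^- 2 * (D / 2) + a ^- 2 * L ^+ 2) =
      2 * (C * (M * D)) + 2 * (M ^+ 2 * L ^+ 2) +
      (4 * C * M * (b / a * L) ^+ 2 + (M * a / b) ^+ 2 * D).
    by rewrite /c; field; rewrite !gt_eqF.
  have M0 : 0 <= M by lra.
  rewrite lerDl; apply: addr_ge0; last exact: mulr_ge0 (sqr_ge0 _) D0.
  by apply: mulr_ge0 (sqr_ge0 _); rewrite !mulr_ge0.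
rewrite -[leRHS]mul1r -w1 mulr_suml; apply: ler_sum => x _.
apply: ler_wpM2l; first exact/ltW.
by apply: le_trans (sqr1 x); exact: entropy_density_le_sqr.
Qed.

End FiniteSums.


(** * One-sided calculus and Gronwall's lemma on the half-line *)

Section HalfLine.
Context {R : realType}.
Implicit Types f : R -> R.

Lemma is_derive_continuous f (t l : R) : is_derive t 1 f l ->
  {for t, continuous f}.
Proof. by move=> [/derivable1_diffP/differentiable_continuous]. Qed.

Lemma is_derive_halfline_cvg f t l : is_derive_halfline f t l ->
  f s @[s --> within `[0, +oo[ (nbhs t)] --> f t.
Proof.
move=> ftl.
have : f t + (f s - f t) / (s - t) * (s - t)
    @[s --> within `[0, +oo[ t^'] --> f t + l * (t - t).
  apply: cvgD; first exact: cvg_cst.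
  apply: cvgM; first exact: ftl.
  apply: cvgB; last exact: cvg_cst.
  by move=> A tA; apply: cvg_within; exact: nbhs_dnbhs.
rewrite subrr mulr0 addr0 => /cvgrPdist_lt cf.
apply/cvgrPdist_lt => e e0; have := cf e e0; rewrite !near_withinE.
apply: filterS => s hs s0; have [->|st] := eqVneq s t.
  by rewrite subrr normr0.
have := hs st s0; rewrite divfK ?subr_eq0//.
by rewrite (addrC (f t) (_ - _)) subrK.
Qed.

(** Near [t > 0] all points are nonnegative, so the restriction to the half-line is void; it remains
    to substitute [s = h + t]. *)
Lemma is_derive_halfline_is_derive f t l : 0 < t -> is_derive_halfline f t l ->
  is_derive t 1 f l.
Proof.
move=> t0 ftl.
have q : h^-1 *: ((f \o shift t) (h *: (1 : R)) - f t) @[h --> (0 : R)^'] --> l.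
  apply/cvgrPdist_lt => e e0.
  have /cvgrPdist_lt/(_ e e0) := ftl; rewrite !near_withinE => near_t.
  have near_pos : \forall s \near t, 0 <= s.
    by near=> s; apply/ltW; near: s; exact: lt_nbhsr.
  have sh : (h + t) @[h --> (0 : R)] --> t.
    rewrite -[X in _ --> X]add0r; apply: cvgD; [exact: cvg_id|exact: cvg_cst].
  near=> h => h0.
  have hpos : 0 <= h + t by near: h; exact: (sh _ near_pos).
  have : h + t != t -> (h + t) \in `[0, +oo[ ->
      `|l - (f (h + t) - f t) / (h + t - t)| < e.
    by near: h; exact: (sh _ near_t).
  rewrite addrK in_itv/= andbT hpos => /(_ _ isT).
  rewrite -subr_eq0 addrK => /(_ h0) /=.
  by rewrite [h *: _]mulr1 [X in _ -> `|l - X| < _]mulrC.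
apply: DeriveDef; last exact: cvg_lim q.
by apply/cvg_ex; exists l.
Unshelve. all: by end_near. Qed.

(** The function [f s * expR (c * s)] has nonpositive derivative for [s > 0] and is continuous up to
    0. *)
Lemma gronwall_halfline f (df : R -> R) (c : R) :
  (forall t : R, 0 <= t -> f s @[s --> within `[0, +oo[ (nbhs t)] --> f t) ->
  (forall t : R, 0 < t -> is_derive t 1 f (df t)) ->
  (forall t : R, 0 < t -> df t <= - (c * f t)) ->
  forall t : R, 0 <= t -> f t <= f 0 * expR (- (c * t)).
Proof.
move=> fc fd fdf t t0; pose g s := f s * expR (c * s).
have ed (s : R) : is_derive s 1 (fun r => expR (c * r)) (expR (c * s) * c).
  have := @is_derive1_comp _ expR (c \*: id) s _ _ (is_derive_expR (c * s))
    (is_deriveZ c (is_derive_id s 1)).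
  by move=> h; apply: (is_derive_eq h); rewrite [c *: _]mulr1.
have gd (s : R) : 0 < s ->
    is_derive s 1 g (f s * (expR (c * s) * c) + expR (c * s) * df s).
  by move=> s0; have := is_deriveM (fd s s0) (ed s).
suff : g t <= g 0.
  by rewrite /g mulr0 expR0 mulr1 expRN ler_pdivlMr ?expR_gt0.
apply: (@ler0_derive1_nincry _ g 0) => //.
- by move=> s; rewrite in_itv/= andbT => /gd[].
- move=> s; rewrite in_itv/= andbT derive1E => s0; have [_ ->] := gd _ s0.
  have -> : f s * (expR (c * s) * c) + expR (c * s) * df s =
    expR (c * s) * (df s + c * f s) by ring.
  by rewrite pmulr_rle0 ?expR_gt0//; have := fdf s s0; lra.
- apply/subspace_continuousP => s /=; rewrite in_itv/= andbT => s0.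
  apply: cvgM; first exact: fc.
  apply: cvg_within_filter.
  exact: is_derive_continuous (ed s).
Qed.

End HalfLine.

(** * Derivative of the entropy along the heat flow *)

Lemma is_derive_fsum {R : realType} {I : finType} (h : I -> R -> R)
    (dh : I -> R) (t : R) :
  (forall i, is_derive t 1 (h i) (dh i)) ->
  is_derive t 1 (fun s => \sum_i h i s) (\sum_i dh i).
Proof.
move=> hd; rewrite (_ : (fun s => _) = \sum_i h i); last first.
  by apply/funext => s; rewrite fct_sumE.
by elim/big_ind2 : _ => // [|] *; [exact: is_derive_cst|exact: is_deriveD].
Qed.

Lemma is_derive_entropy_density {R : realType} (u : R) : 0 < u ->
  is_derive u 1 (fun v => v * ln v - v + 1) (ln u).
Proof.
move=> u0; have := is_deriveD (is_deriveB (is_deriveM (is_derive_id u 1)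
  (is_derive1_ln u0)) (is_derive_id u 1)) (is_derive_cst (1 : R) u 1).
move=> h; apply: (is_derive_eq h).
rewrite addr0 -[_ *: _]/(u * u^-1) -[ln u *: 1]/(ln u * 1).
by rewrite mulr1 divff ?gt_eqF// addrAC subrr add0r.
Qed.

Section HeatFlow.
Context {R : realType} {X : finType}.
Context (K : X -> X -> R) (w p : X -> R) (a b : R).
Context (rho0 : X -> R) (rho : R -> X -> R).
Context (hrev : reversible K w) (hrho : heat_flow K w p a b rho0 rho).

Lemma entropy_heat_flow_cvg (t : R) : 0 <= t ->
  entropy w (rho s) @[s --> within `[0, +oo[ (nbhs t)] --> entropy w (rho t).
Proof.
move=> t0; have [rpos _ rC1] := hrho.
apply: cvg_big => [|x _]; first exact: add_continuous.
apply: cvgM; first exact: cvg_cst.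
have [/(_ t t0)/is_derive_halfline_cvg cr _] := rC1 x.
apply: (@continuous_cvg _ _ _ _ _ (rho^~ x) (fun v => v * ln v - v + 1)) cr.
exact: is_derive_continuous (is_derive_entropy_density (rpos t t0 x)).
Qed.

Lemma is_derive_entropy_heat_flow (t : R) : 0 < t ->
  is_derive t 1 (fun s => entropy w (rho s)) (- dissipation K w p a b (rho t)).
Proof.
move=> t0; have [rpos _ rC1] := hrho; rewrite -inner_ln_heat_field//.
apply: is_derive_fsum => x; have [/(_ t (ltW t0)) dr _] := rC1 x.
by have := is_deriveZ (w x) (is_derive1_comp
  (is_derive_entropy_density (rpos t (ltW t0) x))
  (is_derive_halfline_is_derive t0 dr)).
Qed.

End HeatFlow.

(** * Exponential decay of the entropy and of the L2 distance *)

Theorem theorem4p7 (R : realType) (X : finType) (K : X -> X -> R)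
    (w p : X -> R) (a b : R)
    (hK : markov_kernel K) (hirr : irreducible_kernel K)
    (hw : steady_state K w) (hrev : reversible K w)
    (ha : 0 < a) (hb : 0 < b)
    (hp : positive p) (hp1 : \sum_x w x * p x = 1)
    (rho0 : X -> R) (hrho0 : positive rho0)
    (rho : R -> X -> R) (hrho : heat_flow K w p a b rho0 rho) :
  exists C c : R, [/\ 0 < C, 0 < c &
    forall t : R, 0 <= t ->
      norm2 w (fun x => rho t x - 1) <= C * expR (- (c * t))].
Proof.
have w0 := steady_state_gt0 hK hirr hw.
have w0' x := ltW (w0 x).
have [rpos _ _] := hrho.
set H0 := entropy w (rho 0).
have H0_ge0 : 0 <= H0 by exact/entropy_ge0/rpos.
have Hle t : 0 <= t -> entropy w (rho t) <= H0.
  (* Rate 0 in Gronwall's lemma expresses monotonicity. *)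
  move=> t0; have := @gronwall_halfline _ _ _ 0 (entropy_heat_flow_cvg hrho)
    (is_derive_entropy_heat_flow hrev hrho).
  rewrite -/H0 => /(_ _ t t0); rewrite mul0r oppr0 expR0 mulr1; apply=> s s0.
  by rewrite mul0r lerN2 dissipation_ge0//; exact/rpos/ltW.
(* Summing over [x] makes the bound of [le_entropy] uniform; [expR 1] in place of [expR 1 - 1]
   ensures [1 <= M]. *)
pose M := \sum_x H0 / w x + expR 1.
have M1 : 1 <= M.
  rewrite /M ler_wpDl//; last by rewrite -expR0 ler_expR.
  by apply: sumr_ge0 => x _; exact: divr_ge0.
have rM t x : 0 <= t -> rho t x <= M.
  move=> t0; apply: (le_trans (le_entropy x w0 (rpos t t0))).
  apply: lerD; last by rewrite gerBl.
  rewrite (bigD1 x)//= ler_wpDr//; last by rewrite ler_wpM2r ?invr_ge0 ?Hle.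
  by apply: sumr_ge0 => y _; exact: divr_ge0.
have [c c0 hc] := entropy_dissipation hK hirr hw ha hb hp hp1 M1.
have Hexp t : 0 <= t -> entropy w (rho t) <= H0 * expR (- (c * t)).
  apply: (@gronwall_halfline _ _ _ c (entropy_heat_flow_cvg hrho)
    (is_derive_entropy_heat_flow hrev hrho)) => s s0.
  by rewrite lerN2 hc// => [|x]; [exact/rpos/ltW|exact/rM/ltW].
(* The added 1 keeps [C] positive when [H0 = 0]. *)
pose C := 2 * (M + 1) * H0 + 1.
have C0 : 0 < C by rewrite ltr_wpDl// !mulr_ge0//; lra.
(* The entropy controls the squared norm, so the constant becomes a square root and the rate is
   halved. *)
exists (Num.sqrt C), (c / 2); split; rewrite ?sqrtr_gt0 ?divr_gt0//.
move=> t t0; rewrite -(ler_pXn2r (ltn0Sn 1)) ?nnegrE ?sqrtr_ge0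
  ?mulr_ge0 ?expR_ge0//.
rewrite exprMn -expRM_natl !sqr_sqrtr ?(ltW C0)//; last first.
  by apply: sumr_ge0 => x _; rewrite -expr2 mulr_ge0 ?sqr_ge0.
have -> : 2 * - (c / 2 * t) = - (c * t) by field.
have h : inner w (fun x => rho t x - 1) (fun x => rho t x - 1) <=
    2 * (M + 1) * entropy w (rho t).
  rewrite /entropy mulr_sumr; apply: ler_sum => x _.
  rewrite mulrCA mulrC; apply: ler_wpM2l => //.
  by rewrite -expr2; apply: sqr_le_entropy_density; [exact: rpos|exact: rM].
apply: (le_trans h).
apply: (@le_trans _ _ (2 * (M + 1) * (H0 * expR (- (c * t))))).
  by apply: ler_wpM2l; [lra|exact: Hexp].
by rewrite mulrA ler_wpM2r ?expR_ge0// /C lerDl.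
Qed.
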